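(* Assume the self-similar set $K$ is connected and that there exists $\beta>\alpha$ such that $\mathcal D_K^{(\beta)}$ contains nonconstant functions. Then $\beta_2^*=\beta_3^*$.
   Context: Let $\{S_i\}_{i=1}^N$ ($N\ge2$) be contractive similitudes of $\mathbb R^d$ with ratios $r_i\in(0,1)$ satisfying the open set condition; $K$ is the self-similar set, $\alpha$ its Hausdorff dimension ($\sum_i r_i^\alpha=1$), $\nu$ the normalized $\alpha$-dimensional Hausdorff measure on $K$, $r=\min_ir_i$. For $\beta>0$ let $\mathcal D_K^{(\beta)}$ be the Besov space $\Lambda^{\alpha,\beta/2}_{2,2}=\{u\in L^2(K,\nu):\iint_{K\times K}|u(\xi)-u(\eta)|^2|\xi-\eta|^{-(\alpha+\beta)}d\nu(\xi)d\nu(\eta)<\infty\}$ (it is the domain of the energy form induced on $K$ by the $\lambda$-natural random walk on the augmented tree of $K$, with $\lambda=r^\beta$). Define $\beta_2^*=\sup\{\beta>0:\dim\mathcal D_K^{(\beta)}=\infty\}$ and $\beta_3^*=\sup\{\beta>0:\mathcal D_K^{(\beta)}$ contains nonconstant functions$\}$. *)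

(* Defs.v *)
From HB Require Import structures.
From mathcomp Require Import all_boot all_order all_algebra.
From mathcomp Require Import all_classical all_reals all_analysis.
Import Order.TTheory GRing.Theory Num.Theory numFieldNormedType.Exports.

Set Implicit Arguments.
Unset Strict Implicit.
Unset Printing Implicit Defensive.

Local Open Scope classical_set_scope.
Local Open Scope ring_scope.

Section SelfSimilar.
Variables (R : realType) (d : nat).

Definition enorm (x : 'rV[R]_d) : R := Num.sqrt (\sum_(i < d) x ord0 i ^+ 2).

Definition is_similitude (S : 'rV[R]_d -> 'rV[R]_d) (r : R) : Prop :=
  forall x y, enorm (S x - S y) = r * enorm (x - y).

Definition ebounded (V : set 'rV[R]_d) : Prop :=
  exists M : R, forall x, V x -> enorm x <= M.

Definition OSC (N : nat) (S : 'I_N -> 'rV[R]_d -> 'rV[R]_d) : Prop :=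
  exists V : set 'rV[R]_d, [/\ open V, V !=set0, ebounded V,
    (forall i, S i @` V `<=` V) &
    (forall i j, i != j -> S i @` V `&` S j @` V = set0)].

Definition attractor (N : nat) (S : 'I_N -> 'rV[R]_d -> 'rV[R]_d) (K : set 'rV[R]_d) : Prop :=
  [/\ compact K, K !=set0 & K = \bigcup_i (S i @` K)].

(* Euclidean diameter (-oo for the empty set). *)
Definition ediam (U : set 'rV[R]_d) : \bar R :=
  ereal_sup [set (enorm (x - y))%:E | x in U & y in U].

(* diam(U)^s, with the convention diam(empty)^s = 0. *)
Definition hterm (s : R) (U : set 'rV[R]_d) : \bar R :=
  match ediam U with
  | EFin t => (t `^ s)%:E
  | EPInf => +oo%E
  | ENInf => 0%E
  end.

Definition hcontent (s delta : R) (A : set 'rV[R]_d) : \bar R :=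
  ereal_inf [set (\sum_(0 <= n <oo) hterm s (U n))%E
            | U in [set U : nat -> set 'rV[R]_d |
                     A `<=` \bigcup_n U n /\ forall n, (ediam (U n) <= delta%:E)%E]].

Definition hmeasure (s : R) (A : set 'rV[R]_d) : \bar R :=
  ereal_sup [set hcontent s delta A | delta in [set delta : R | 0 < delta]].

Definition Rd := g_sigma_algebraType (@open 'rV[R]_d).

Definition normalized_hausdorff (nu : {measure set Rd -> \bar R}) (a : R)
    (K : set 'rV[R]_d) : Prop :=
  forall A : set Rd, measurable A ->
    nu A = (fine (hmeasure a (A `&` K)) / fine (hmeasure a K))%:E.

Definition besov (nu : {measure set Rd -> \bar R}) (K : set 'rV[R]_d) (a b : R)
    (u : Rd -> R) : Prop :=
  [/\ measurable_fun setT u,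
      (\int[nu]_(x in (K : set Rd)) (`|u x| ^+ 2)%:E < +oo)%E &
      (\int[nu]_(x in (K : set Rd)) \int[nu]_(y in (K : set Rd))
          ((`|u x - u y| ^+ 2) /
             (enorm ((x : 'rV[R]_d) - (y : 'rV[R]_d))) `^ (a + b))%:E < +oo)%E].

Definition infinite_dim (nu : {measure set Rd -> \bar R}) (D : (Rd -> R) -> Prop) : Prop :=
  forall n : nat, exists u : 'I_n -> Rd -> R,
    (forall i, D (u i)) /\
    forall c : 'I_n -> R,
      {ae nu, forall x, \sum_(i < n) c i * u i x = 0} -> forall i, c i = 0.

Definition has_nonconstant (nu : {measure set Rd -> \bar R}) (D : (Rd -> R) -> Prop) : Prop :=
  exists u, D u /\ ~ (exists c : R, {ae nu, forall x, u x = c}).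

Definition beta2 (nu : {measure set Rd -> \bar R}) (K : set 'rV[R]_d) (a : R) : \bar R :=
  ereal_sup [set b%:E | b in [set b : R | 0 < b /\ infinite_dim nu (besov nu K a b)]].

Definition beta3 (nu : {measure set Rd -> \bar R}) (K : set 'rV[R]_d) (a : R) : \bar R :=
  ereal_sup [set b%:E | b in [set b : R | 0 < b /\ has_nonconstant nu (besov nu K a b)]].

End SelfSimilar.

(* Main.v *)
(** A nonconstant [u] in the Besov space with [beta > alpha] has an essential
    range without gaps; composing it with tent functions supported on disjoint
    subintervals then yields any number of independent elements of the space.

    No gaps: suppose [u <= a] and [u >= c], with [a < c], have positive measure
    and together full measure.  Cut [K] at scale [rho] into cells [S_w K], with
    [nu (S_w K) = r_w `^ alpha] comparable to [rho `^ alpha].  If two cells meet,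
    then [nu (u >= c in one) * nu (u <= a in the other)] is at most a constant
    times [rho `^ (alpha + beta)], that is [rho `^ (beta - alpha)] relative to
    the squared cell mass.  So for small [rho] each cell lies almost entirely in
    one of the two sets, the same one for cells that meet, hence, [K] being
    connected, the same one for all cells: a contradiction.

    A nonconstant function exists only if [nu <> 0], that is
    [0 < H^alpha K < oo]; the masses of the cells then follow from the scaling
    of the Hausdorff measure. *)

Require Import Defs.
From HB Require Import structures.
From mathcomp Require Import all_boot all_order all_algebra.
From mathcomp Require Import all_classical all_reals all_analysis.
From mathcomp Require Import measurable_realfun ring lra.
Import Order.TTheory GRing.Theory Num.Theory numFieldNormedType.Exports.
Local Open Scope classical_set_scope.
Local Open Scope ring_scope.

(** * Euclidean norm, similitudes and bounded sets *)

Section Euclidean.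
Context {R : realType} {d : nat}.
Implicit Types x y z : 'rV[R]_d.

Lemma enorm_ge0 x : 0 <= enorm x.
Proof. exact: sqrtr_ge0. Qed.

Lemma sqr_enorm x : enorm x ^+ 2 = \sum_(i < d) x ord0 i ^+ 2.
Proof. by rewrite sqr_sqrtr // sumr_ge0 // => i _; exact: sqr_ge0. Qed.

Lemma enorm_le x (M : R) : 0 <= M -> enorm x ^+ 2 <= M ^+ 2 -> enorm x <= M.
Proof. by move=> M0; rewrite ler_pXn2r // ?nnegrE ?enorm_ge0. Qed.

Lemma normr_coord_le_enorm x i : `|x ord0 i| <= enorm x.
Proof.
rewrite -(ler_pXn2r (n := 2)) ?nnegrE ?enorm_ge0 // sqr_enorm real_normK ?num_real //.
by rewrite (bigD1 i) //= lerDl sumr_ge0 // => j _; exact: sqr_ge0.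
Qed.

Lemma normr_le_enorm x : `|x| <= enorm x.
Proof.
rewrite [leLHS]mx_normrE; apply/bigmax_leP; split => [|[i j] _ /=]; first exact: enorm_ge0.
by rewrite ord1; exact: normr_coord_le_enorm.
Qed.

Lemma enorm_le_normr x : enorm x <= d%:R * `|x|.
Proof.
apply: enorm_le; first exact: mulr_ge0.
rewrite sqr_enorm exprMn; apply: (@le_trans _ _ (d%:R * `|x| ^+ 2)).
  rewrite mulr_natl -[X in _ *+ X]card_ord -sumr_const ler_sum // => i _.
  rewrite -real_normK ?num_real // ler_pXn2r ?nnegrE // [leRHS]mx_normrE.
  exact: (le_bigmax _ (fun ij => `|x ij.1 ij.2|) (ord0, i)).
apply: ler_wpM2r; first exact: sqr_ge0.
by rewrite -natrX ler_nat; case: (d) => // n; rewrite leq_pmulr.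
Qed.

Lemma enorm_eq0 x : enorm x = 0 -> x = 0.
Proof. by move=> x0; apply/normr0_eq0/eqP; rewrite eq_le normr_ge0 -x0 normr_le_enorm. Qed.

Lemma enorm0 : enorm (0 : 'rV[R]_d) = 0.
Proof. by apply/eqP; rewrite eq_le enorm_ge0 (le_trans (enorm_le_normr _)) // normr0 mulr0. Qed.

(* Parallelogram bound: a doubled radius needs no Cauchy-Schwarz. *)
Lemma enorm_sub_le x y z (M : R) :
  enorm (x - z) <= M -> enorm (z - y) <= M -> enorm (x - y) <= 2 * M.
Proof.
move=> h1 h2; have M0 : 0 <= M by exact: le_trans (enorm_ge0 _) h1.
apply: enorm_le; first exact: mulr_ge0.
have e1 : enorm (x - z) ^+ 2 <= M ^+ 2 by rewrite ler_pXn2r ?nnegrE ?enorm_ge0.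
have e2 : enorm (z - y) ^+ 2 <= M ^+ 2 by rewrite ler_pXn2r ?nnegrE ?enorm_ge0.
apply: (@le_trans _ _ (2 * (enorm (x - z) ^+ 2 + enorm (z - y) ^+ 2))); last lra.
rewrite !sqr_enorm -big_split /= mulr_sumr ler_sum // => i _; rewrite !mxE.
have := sqr_ge0 (x ord0 i - z ord0 i - (z ord0 i - y ord0 i)); nra.
Qed.

Lemma similitude_continuous (f : 'rV[R]_d -> 'rV[R]_d) (s : R) :
  0 < s -> is_similitude f s -> continuous f.
Proof.
move=> s0 sf x; apply/(cvgrPdist_lt (FF := nbhs_filter x)) => /= e e0.
have k0 : 0 < s * (d%:R + 1) by apply: mulr_gt0.
apply/nbhs_ballP; exists (e / (s * (d%:R + 1))) => /=; first exact: divr_gt0.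
move=> y; rewrite -ball_normE /= ltr_pdivlMr //; apply: le_lt_trans.
apply: le_trans (normr_le_enorm _) _; rewrite sf [leRHS]mulrCA.
rewrite ler_pM2l //; apply: le_trans (enorm_le_normr _) _.
by rewrite mulrC ler_wpM2l // lerDl.
Qed.

Lemma similitude_comp (f g : 'rV[R]_d -> 'rV[R]_d) (s t : R) :
  is_similitude f s -> is_similitude g t -> is_similitude (f \o g) (s * t).
Proof. by move=> sf sg x y /=; rewrite sf sg mulrA. Qed.

Lemma similitude_inj (f : 'rV[R]_d -> 'rV[R]_d) (s : R) :
  s != 0 -> is_similitude f s -> injective f.
Proof.
move=> s0 sf x y fxy; apply/eqP; rewrite -subr_eq0; apply/eqP/enorm_eq0.
have := sf x y; rewrite fxy subrr enorm0 => /esym/eqP.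
by rewrite mulf_eq0 (negPf s0) => /eqP.
Qed.

Lemma compact_ediam (K : set 'rV[R]_d) : compact K ->
  exists2 D : R, 0 < D & forall x y, K x -> K y -> enorm (x - y) <= D.
Proof.
move=> /compact_bounded/pinfty_ex_gt0[M M0 hM]; exists (2 * (d%:R * M) + 1).
  by rewrite ltr_wpDl // !mulr_ge0 // ltW.
move=> x y Kx Ky; apply: (@le_trans _ _ (2 * (d%:R * M))); last by rewrite lerDl.
have b z : K z -> enorm z <= d%:R * M.
  by move=> /hM Mz; apply: le_trans (enorm_le_normr _) _; rewrite ler_wpM2l.
apply: (@enorm_sub_le _ _ 0); first by rewrite subr0 b.
by rewrite /enorm (eq_bigr (fun i => y ord0 i ^+ 2)) ?b// => i _; rewrite !mxE sub0r sqrrN.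
Qed.

End Euclidean.

(** * Scaling of the Hausdorff measure under similitudes *)

Section Hausdorff.
Context {R : realType} {d : nat}.
Implicit Types (U V A : set 'rV[R]_d) (s alpha delta : R).

Lemma ediam_set0 : ediam (set0 : set 'rV[R]_d) = -oo%E.
Proof.
rewrite /ediam [X in ereal_sup X](_ : _ = set0) ?ereal_sup0 //.
by apply/seteqP; split => // t [].
Qed.

Lemma ediam_EFin_ge0 U t : ediam U = t%:E -> 0 <= t.
Proof.
have [->|/set0P[x Ux]] := eqVneq U set0.
  by rewrite ediam_set0.
move=> dU; rewrite -lee_fin -dU -(@enorm0 R d) -(subrr x) ereal_sup_ubound //.
by exists x => //; exists x.
Qed.

Lemma ediam_image_le (g : 'rV[R]_d -> 'rV[R]_d) s A U : 0 < s ->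
  (forall x y, A x -> A y -> enorm (g x - g y) <= s * enorm (x - y)) ->
  (ediam (g @` (U `&` A)) <= s%:E * ediam U)%E.
Proof.
move=> s0 gs; apply: ge_ereal_sup => _ [_ [x [Ux Ax] <-]] [_ [y [Uy Ay] <-]] <-.
apply: (@le_trans _ _ (s%:E * (enorm (x - y))%:E)%E).
  by rewrite -EFinM lee_fin gs.
by rewrite lee_pmul2l // ereal_sup_ubound //; exists x => //; exists y.
Qed.

Lemma hterm_ge0 alpha U : (0 <= hterm alpha U)%E.
Proof. by rewrite /hterm; case: ediam => //= t; rewrite lee_fin powR_ge0. Qed.

Lemma hterm_le alpha s U V : 0 <= alpha -> 0 < s ->
  (ediam V <= s%:E * ediam U)%E ->
  (hterm alpha V <= (s `^ alpha)%:E * hterm alpha U)%E.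
Proof.
move=> a0 s0; have sa : (0 < (s `^ alpha)%:E)%E by rewrite lte_fin powR_gt0.
rewrite {2}/hterm; case dU : (ediam U) => [t| |] /= dV.
- rewrite /hterm; case: (ediam V) dV (@ediam_EFin_ge0 V) => [t'| |] //= dV tV.
  + have t0 := ediam_EFin_ge0 _ _ dU; have t'0 := tV _ erefl.
    rewrite -EFinM lee_fin -powRM ?(ltW s0) //.
    by rewrite ge0_ler_powR // nnegrE // mulr_ge0 // ltW.
  + by rewrite -EFinM lee_fin mulr_ge0 // powR_ge0.
- by rewrite gt0_muley // leey.
- move: dV; rewrite gt0_muleNy // leeNy_eq mule0 /hterm => /eqP ->; exact: lexx.
Qed.

(** The Lipschitz bound is asked on [A] only, since the inverse of a similitude is controlled only
    on the image. A cover of mesh [delta / s], cut down to [A], has images of mesh at most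
    [delta]. *)
Lemma hmeasure_lipschitz_le (g : 'rV[R]_d -> 'rV[R]_d) alpha s A : 0 <= alpha -> 0 < s ->
  (forall x y, A x -> A y -> enorm (g x - g y) <= s * enorm (x - y)) ->
  (hmeasure alpha (g @` A) <= (s `^ alpha)%:E * hmeasure alpha A)%E.
Proof.
move=> a0 s0 gs; have sa : 0 < s `^ alpha by rewrite powR_gt0.
apply: ge_ereal_sup => _ [delta /= delta0 <-].
rewrite -lee_pdivrMl //.
apply: le_trans (ereal_sup_ubound _); last first.
  by exists (delta / s) => //=; exact: divr_gt0.
apply: le_ereal_inf_tmp => _ [U [AU dU] <-]; rewrite lee_pdivrMl //.
pose V n := g @` (U n `&` A).
apply: (@le_trans _ _ (\sum_(0 <= n <oo) hterm alpha (V n))%E).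
  apply: ereal_inf_lbound; exists V => //; split.
    by move=> _ [x Ax <-]; have [n _ Ux] := AU x Ax; exists n => //; exists x.
  move=> n; apply: le_trans (ediam_image_le _ _ _ _ s0 gs) _.
  by rewrite -lee_pdivlMl // -EFinM mulrC; exact: dU.
rewrite -nneseriesZl; last by move=> *; exact: hterm_ge0.
apply: lee_nneseries => [n _ _|n _]; first exact: hterm_ge0.
by apply: hterm_le => //; exact: ediam_image_le.
Qed.

Lemma hmeasure_similitude (f : 'rV[R]_d -> 'rV[R]_d) alpha s A : 0 <= alpha -> 0 < s ->
  is_similitude f s -> (hmeasure alpha (f @` A) = (s `^ alpha)%:E * hmeasure alpha A)%E.
Proof.
move=> a0 s0 sf; apply/eqP; rewrite eq_le; apply/andP; split.
  by apply: hmeasure_lipschitz_le => // x y _ _; rewrite sf.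
have injf := similitude_inj _ _ (lt0r_neq0 s0) sf.
(* A left inverse of [f], with junk value 0 off the range. It is [s^-1]-Lipschitz on the image of
   [A], which gives the reverse inequality. *)
pose g y := xget 0 [set x | f x = y].
have fK : cancel f g.
  by move=> x; apply: injf; apply: (@xgetPex _ 0 [set z | f z = f x]); exists x.
have gfA : A = g @` (f @` A).
  apply/seteqP; split => [x Ax|_ [_ [x Ax <-] <-]]; rewrite ?fK //.
  by exists (f x); rewrite ?fK //; exists x.
have e : (s `^ alpha)^-1 = s^-1 `^ alpha by rewrite -powRN -mulN1r powRrM powR_inv1 // ltW.
rewrite -lee_pdivlMl ?powR_gt0 // e [in leLHS]gfA.
apply: hmeasure_lipschitz_le => //; first by rewrite invr_gt0.
move=> _ _ [x Ax <-] [y Ay <-].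
by rewrite !fK sf mulrA mulVf ?mul1r // lt0r_neq0.
Qed.

End Hausdorff.

(** * Words, cells and cut sets *)

Section Words.
Context {R : realType} {d N : nat}.
Implicit Types (S : 'I_N -> 'rV[R]_d -> 'rV[R]_d) (r : 'I_N -> R) (w : seq 'I_N).

(** The head of the word acts last, so appending a letter at the end passes to a subcell. *)
Definition wmap S w : 'rV[R]_d -> 'rV[R]_d := foldr (fun i g => S i \o g) id w.

Definition wratio r w : R := \prod_(i <- w) r i.

Lemma wmap_rcons S w i : wmap S (rcons w i) = wmap S w \o S i.
Proof. by elim: w => //= j w ->. Qed.

Lemma wratio_rcons r w i : wratio r (rcons w i) = wratio r w * r i.
Proof. by rewrite /wratio -cats1 big_cat big_seq1. Qed.

Lemma wratio_gt0 r w : (forall i, 0 < r i < 1) -> 0 < wratio r w.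
Proof. by move=> hr; apply: prodr_gt0 => i _; have /andP[] := hr i. Qed.

Lemma wmap_similitude S r w : (forall i, is_similitude (S i) (r i)) ->
  is_similitude (wmap S w) (wratio r w).
Proof.
move=> Ss; rewrite /wratio; elim: w => [|i w IH] x y /=; first by rewrite big_nil mul1r.
by rewrite big_cons; exact: similitude_comp.
Qed.

Lemma wmap_sub S (K : set 'rV[R]_d) w : K = \bigcup_i (S i @` K) -> wmap S w @` K `<=` K.
Proof.
move=> KS; elim: w => [|i w IH] _ [x Kx <-] //=.
by rewrite KS; exists i => //; exists (wmap S w x) => //; apply: IH; exists x.
Qed.

Lemma ratio_lower_bound r : (forall i, 0 < r i < 1) ->
  exists2 q, 0 < q & forall i, q <= r i.
Proof.
move=> hr; exists (\prod_i r i); first by apply: prodr_gt0 => i _; have /andP[] := hr i.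
move=> i; rewrite (bigD1 i) //= ler_piMr //; first by have /andP[/ltW] := hr i.
by apply: prodr_ile1 => j _; have /andP[/ltW-> /ltW] := hr j.
Qed.

Lemma ratio_upper_bound r : (forall i, 0 < r i < 1) ->
  exists2 t, 0 <= t < 1 & forall i, r i <= t.
Proof.
move=> hr; have [|q q0 hq] := ratio_lower_bound (fun i => 1 - r i).
  by move=> i; have /andP[] := hr i; lra.
(* Without any index, [q] may exceed 1; the maximum keeps the bound nonnegative. *)
exists (Num.max 0 (1 - q)) => [|i]; first by rewrite le_max lexx /= gt_max ltr01 /=; lra.
by rewrite le_max; apply/orP; right; have := hq i; lra.
Qed.

(** One round of refinement: words of ratio above [rho] are replaced by their children. Only those
    are split, so ratios stay at least [rho * q]; a word still too large has gained a factor at most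
    [t] in each round, whence [t ^+ m]. The equation for [alpha] preserves the sum. *)
Lemma cut_set_step S r (K : set 'rV[R]_d) (alpha rho q t : R) (L : seq (seq 'I_N)) (m : nat) :
  (forall i, 0 < r i < 1) -> (forall i, q <= r i <= t) ->
  K = \bigcup_i (S i @` K) -> \sum_(i < N) r i `^ alpha = 1 ->
  0 < rho -> 0 < q < 1 ->
  (forall w, w \in L -> rho * q <= wratio r w <= Num.max rho (t ^+ m)) ->
  (forall x, K x -> exists2 w, w \in L & (wmap S w @` K) x) ->
  \sum_(w <- L) wratio r w `^ alpha = 1 ->
  exists L' : seq (seq 'I_N),
  [/\ forall w, w \in L' -> rho * q <= wratio r w <= Num.max rho (t ^+ m.+1),
      forall x, K x -> exists2 w, w \in L' & (wmap S w @` K) x &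
      \sum_(w <- L') wratio r w `^ alpha = 1].
Proof.
move=> hr qrt KS sumr rho0 /andP[q0 q1] Lb Lcov Lsum.
pose ref w := if wratio r w <= rho then [:: w] else [seq rcons w i | i <- enum 'I_N].
exists (flatten [seq ref w | w <- L]); split.
- move=> w' /flatten_mapP[w wL]; have /andP[w1 w2] := Lb w wL.
  rewrite /ref; case: ifPn => [wr|]; last rewrite -ltNge => wr.
    by rewrite inE => /eqP ->; rewrite w1 le_max wr.
  move=> /mapP[i _ ->]; rewrite wratio_rcons; have /andP[qi it] := qrt i.
  have /andP[ri0 ri1] := hr i; have w0 := wratio_gt0 r w hr.
  rewrite ler_pM //=; [|exact: ltW..]; rewrite le_max; apply/orP; right.
  rewrite exprSr ler_pM //; [exact: ltW..|].
  by move: w2; rewrite le_max leNgt wr.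
- move=> x /Lcov[w wL [y Ky xy]].
  case: (boolP (wratio r w <= rho)) => wr.
    exists w; last by exists y.
    by apply/flatten_mapP; exists w => //; rewrite /ref wr inE.
  move: (Ky); rewrite {1}KS => -[i _ [z Kz zy]]; exists (rcons w i).
    apply/flatten_mapP; exists w => //; rewrite /ref (negPf wr).
    by apply: map_f; rewrite mem_enum.
  by exists z => //; rewrite wmap_rcons /= zy.
- rewrite big_flatten big_map -Lsum; apply: eq_bigr => w _.
  rewrite /ref; case: ifP => _; first by rewrite big_seq1.
  rewrite big_map big_enum /= -[RHS]mulr1 -sumr mulr_sumr; apply: eq_bigr => i _.
  rewrite wratio_rcons powRM //; [exact/ltW/wratio_gt0|].
  by have /andP[/ltW] := hr i.
Qed.

Lemma cut_set S r (K : set 'rV[R]_d) (alpha q : R) :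
  (forall i, 0 < r i < 1) -> 0 < q < 1 -> (forall i, q <= r i) ->
  K = \bigcup_i (S i @` K) -> \sum_(i < N) r i `^ alpha = 1 ->
  forall rho, 0 < rho < 1 -> exists L : seq (seq 'I_N),
  [/\ forall w, w \in L -> rho * q <= wratio r w <= rho,
      forall x, K x -> exists2 w, w \in L & (wmap S w @` K) x &
      \sum_(w <- L) wratio r w `^ alpha = 1].
Proof.
move=> hr q01 hq KS sumr rho /andP[rho0 rho1].
have [t /andP[t0 t1] ht] := ratio_upper_bound r hr.
have [m tm] : exists m, t ^+ m <= rho.
  have : t ^+ n @[n --> \oo] --> (0 : R) by apply: cvg_expr; rewrite ger0_norm.
  move=> /cvgrPdist_lt/(_ _ rho0)[m _ /(_ m (leqnn m))] /=.
  by rewrite sub0r normrN ger0_norm ?exprn_ge0 // => /ltW; exists m.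
(* Once [t ^+ m <= rho] the maximum is [rho], so [m] rounds starting from the empty word suffice. *)
suff [L [L1 L2 L3]] : exists L : seq (seq 'I_N),
  [/\ forall w, w \in L -> rho * q <= wratio r w <= Num.max rho (t ^+ m),
      forall x, K x -> exists2 w, w \in L & (wmap S w @` K) x &
      \sum_(w <- L) wratio r w `^ alpha = 1].
  by exists L; split => // w /L1; rewrite max_l.
elim: m {tm} => [|m [L [L1 L2 L3]]].
  exists [:: [::]]; split.
  - move=> w; rewrite inE => /eqP ->; rewrite /wratio big_nil le_max lexx orbT andbT.
    by have /andP[q0 q1] := q01; rewrite -(mulr1 1) ler_pM // ltW.
  - by move=> x Kx; exists [::]; rewrite ?inE //; exists x.
  - by rewrite big_seq1 /wratio big_nil powR1.
by apply: (@cut_set_step S r K alpha rho q t L m) => // i; rewrite hq ht.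
Qed.

End Words.

(** The union of the cells satisfying [P] is closed, and its complement in [K] is the union of the
    others, since cells that meet agree on [P]. It is thus clopen in [K] and nonempty, hence all of
    [K]; every cell then meets one satisfying [P]. *)
Lemma connected_cells (T : topologicalType) (I : choiceType) (K : set T) (L : seq I)
    (E : I -> set T) (P : pred I) :
  connected K -> (forall w, w \in L -> closed (E w)) ->
  (forall w, w \in L -> E w !=set0) ->
  (forall w, w \in L -> E w `<=` K) ->
  (forall x, K x -> exists2 w, w \in L & E w x) ->
  (forall v w x, v \in L -> w \in L -> E v x -> E w x -> P v -> P w) ->
  (exists2 w, w \in L & P w) -> forall w, w \in L -> P w.
Proof.
move=> Kc Ecl En0 EK KE adj [v vL Pv] w wL.
pose U (Q : pred I) := \bigcup_(z in [set z | z \in L /\ Q z]) E z.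
have Ucl Q : closed (U Q).
  apply: closed_bigcup => [|z [zL _]]; last exact: Ecl.
  by apply: (@sub_finite_set _ _ [set` L]) => [z []|] //; exact: finite_seq.
have UK Q : U Q `<=` K by move=> x [z [zL _]]; exact: EK.
have KU : U P = K `&` ~` U (predC P).
  apply/seteqP; split => [x [z [zL Pz] zx]|x [Kx nx]].
    split; first exact: EK zx.
    by move=> [y [yL /= /negP Py] yx]; apply: Py; exact: adj zx yx Pz.
  have [z zL zx] := KE x Kx; exists z => //; split => //.
  by apply: contrapT => /negP Pz; apply: nx; exists z.
have UPK : U P = K.
  apply: Kc; first by have [x vx] := En0 v vL; exists x; exists v.
  - by exists (~` U (predC P)) => //; exact: closed_openC.
  - by exists (U P) => //; apply/esym/setIidPr.
have [x wx] := En0 w wL; have : U P x by rewrite UPK; exact: EK wx.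
by move=> [z [zL Pz] zx]; exact: adj zx wx Pz.
Qed.

(** * Lower bounds for double integrals, and covering estimates *)

Section Integral.
Local Open Scope ereal_scope.
Context {dd} {T : measurableType dd} {R : realType} (mu : {measure set T -> \bar R}).

(* Unlike [ge0_le_integral], this needs no measurability, so no joint
   measurability of the energy integrand is ever required. *)
Lemma le_integral_nonneg (D : set T) (f g : T -> \bar R) :
  (forall x, D x -> 0 <= f x) -> (forall x, D x -> f x <= g x) ->
  \int[mu]_(x in D) f x <= \int[mu]_(x in D) g x.
Proof.
move=> f0 fg; rewrite !ge0_integralE => [|x Dx|//]; last exact: le_trans (f0 x Dx) (fg x Dx).
apply: ereal_sup_le => _ [h /= hf <-]; exists h => //= x; apply: le_trans (hf x) _.
by rewrite /patch; case: ifPn => // /set_mem /fg.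
Qed.

(** Two comparisons in one variable: for [x] in [A] the inner integrand is at least [k] on [B], and
    for other [x] the inner integral is nonnegative. *)
Lemma double_integral_ge (K A B : set T) (k : R) (F : T -> T -> \bar R) :
  measurable K -> measurable A -> measurable B -> (0 <= k)%R ->
  (forall x y, 0 <= F x y) -> (forall x y, A x -> B y -> k%:E <= F x y) ->
  k%:E * mu (B `&` K) * mu (A `&` K) <=
    \int[mu]_(x in K) \int[mu]_(y in K) F x y.
Proof.
move=> mK mA mB k0 F0 kF.
have c0 : 0 <= k%:E * mu (B `&` K) by rewrite mule_ge0 // lee_fin.
rewrite -(integral_indic mu mK mA) -ge0_integralZl //; last first.
  by apply/measurable_EFinP; exact: measurable_indic.
apply: le_integral_nonneg => x Kx; first by rewrite mule_ge0 // lee_fin.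
rewrite indicE; case: (boolP (x \in A)) => [/set_mem Ax|_]; last first.
  by rewrite mule0 integral_ge0.
rewrite mule1 -(integral_indic mu mK mB) -ge0_integralZl //; last first.
  by apply/measurable_EFinP; exact: measurable_indic.
apply: le_integral_nonneg => y Ky; first by rewrite mule_ge0 // lee_fin.
rewrite indicE; case: (boolP (y \in B)) => [/set_mem By|_]; last by rewrite mule0.
by rewrite mule1 kF.
Qed.

Lemma measure_cover_le (I : Type) (L : seq I) (E : I -> set T) (A : set T) :
  measurable A -> (forall w, measurable (E w)) ->
  A `<=` \big[setU/set0]_(w <- L) E w ->
  mu A <= \sum_(w <- L) mu (A `&` E w).
Proof.
move=> + mE; elim: L A => [|w L IH] A mA.
  by rewrite !big_nil subset0 => ->; rewrite measure0.
rewrite !big_cons => AE.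
have mAE : measurable (A `\` E w) by exact: measurableD.
apply: (@le_trans _ _ (mu (A `&` E w) + mu (A `\` E w))).
  rewrite -[X in mu X <= _](setUIDK A (E w)).
  by rewrite measureU2 //; exact: measurableI.
apply: leeD2l; apply: le_trans (IH _ mAE _) _.
  by move=> x [Ax nE]; case: (AE x Ax).
apply: lee_sum => v _; apply: le_measure; rewrite ?inE; [exact: measurableI..|].
by move=> x [[Ax _] Ex].
Qed.

End Integral.

(** * Measurability of level sets *)

Section LevelSets.
Context {dd} {T : measurableType dd} {R : realType} (u : T -> R).
Context (mu_u : measurable_fun setT u).

Lemma measurable_sublevel a : measurable [set x | u x <= a].
Proof.
have := mu_u measurableT `]-oo, a]%classic (measurable_itv _); rewrite setTI.
by congr measurable; apply/seteqP; split => x /=; rewrite in_itv.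
Qed.

Lemma measurable_superlevel c : measurable [set x | c <= u x].
Proof.
have := mu_u measurableT `[c, +oo[%classic (measurable_itv _); rewrite setTI.
by congr measurable; apply/seteqP; split => x /=; rewrite in_itv /= andbT.
Qed.

Lemma measurable_between a c : measurable [set x | a < u x < c].
Proof.
have := mu_u measurableT `]a, c[%classic (measurable_itv _); rewrite setTI.
by congr measurable; apply/seteqP; split => x /=; rewrite in_itv.
Qed.

End LevelSets.

(** * Choice of the scale *)

Lemma powR_small {R : realType} (C g e : R) : 0 < g -> 0 < e ->
  exists2 rho, 0 < rho < 1 & C * rho `^ g <= e.
Proof.
move=> g0 e0; have C1 : 0 < `|C| + 1 by rewrite ltr_wpDl.
(* The first term keeps [rho] below 1; the second solves [C' * rho ^ g = e] for C' = |C| + 1, which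
   is positive whatever the sign of [C]. *)
exists (Num.min 2^-1 ((e / (`|C| + 1)) `^ g^-1)).
  rewrite lt_min powR_gt0 ?divr_gt0 // andbT invr_gt0 ltr0n /=.
  by rewrite gt_min invf_lt1 ?ltr1n.
apply: (@le_trans _ _ ((`|C| + 1) * (e / (`|C| + 1)))); last first.
  by rewrite mulrCA divff ?mulr1 // gt_eqF.
apply: (@le_trans _ _ ((`|C| + 1) * (Num.min 2^-1 ((e / (`|C| + 1)) `^ g^-1)) `^ g)).
  by rewrite ler_wpM2r ?powR_ge0 //; have := ler_norm C; lra.
set x := e / _; have x0 : 0 < x by exact: divr_gt0.
have {2}-> : x = (x `^ g^-1) `^ g by rewrite -powRrM mulVf ?powRr1 ?gt_eqF // ltW.
rewrite ler_pM2l //; apply: ge0_ler_powR; rewrite ?nnegrE ?(ltW g0) ?powR_ge0 //.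
  by rewrite le_min powR_ge0 invr_ge0 ler0n.
by rewrite ge_min lexx orbT.
Qed.

(** As [a + b = (b - a) + 2 * a], the left side is, up to constants, [rho ^ (b - a)] times the
    square of the cell mass [rho ^ a]; the hypothesis [a < b] makes the first factor small. *)
Lemma scale_choice {R : realType} (I D q a b e dl : R) :
  0 < D -> 0 < q -> a < b -> 0 < e -> 0 < dl ->
  exists2 rho, 0 < rho < 1 &
    I * (2 * (rho * D)) `^ (a + b) <= e * dl * ((rho * q) `^ a) ^+ 2.
Proof.
move=> D0 q0 ab e0 dl0.
have [||rho rho01 hrho] := powR_small (I * (2 * D) `^ (a + b)) (b - a) (e * dl * (q `^ a) ^+ 2).
- by rewrite subr_gt0.
- by rewrite !mulr_gt0 ?powR_gt0.
exists rho => //; have /andP[/[dup] rho0 /ltW rho0' _] := rho01.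
have -> : 2 * (rho * D) = 2 * D * rho by ring.
rewrite [(2 * D * _) `^ _]powRM ?mulr_ge0 ?(ltW D0) // [(rho * q) `^ _]powRM ?(ltW q0) // exprMn.
have -> : rho `^ (a + b) = rho `^ (b - a) * (rho `^ a) ^+ 2.
  rewrite expr2 -!powRD ?(gt_eqF rho0) ?implybT //; congr (_ `^ _); ring.
have P0 : 0 <= (rho `^ a) ^+ 2 by exact: sqr_ge0.
by have := ler_wpM2r P0 hrho; congr (_ <= _); ring.
Qed.

Lemma closed_measurable_Rd {R : realType} {d : nat} (A : set 'rV[R]_d) :
  closed A -> measurable (A : set (Rd R d)).
Proof.
move=> cA; rewrite -(setCK A); apply: measurableC.
by apply: sub_sigma_algebra; exact: closed_openC.
Qed.

(** Used for two cells of masses [mv] and [mw]: if one level set fills half of the first cell, the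
    energy bound on the product leaves the other level set a small share of the second. *)
Lemma half_mass_le {R : realType} (m0 mv mw av bw e : R) : 0 < m0 -> m0 <= mv -> m0 <= mw ->
  0 <= e -> 0 <= bw -> mv / 2 <= av -> av * bw <= e * m0 ^+ 2 -> bw <= 2 * e * mw.
Proof.
move=> m00 hv hw e0 b0 ha hab; apply: (@le_trans _ _ (2 * e * m0)); last first.
  by rewrite ler_wpM2l // mulr_ge0.
have : m0 / 2 * bw <= e * m0 ^+ 2 by apply: le_trans hab; rewrite ler_wpM2r //; lra.
have -> : m0 / 2 * bw = m0 * bw / 2 by ring.
rewrite ler_pdivrMr // => h; rewrite -(ler_pM2l m00).
by have -> : m0 * (2 * e * m0) = e * m0 ^+ 2 * 2 by ring.
Qed.

(** * The normalized Hausdorff measure on [K] *)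

Section NormalizedHausdorff.
Context {R : realType} {d : nat} (K : set 'rV[R]_d) (alpha : R).
Context (nu : {measure set (Rd R d) -> \bar R}) (hnu : normalized_hausdorff nu alpha K).

Lemma nu_fin (A : set (Rd R d)) : measurable A -> nu A \is a fin_num.
Proof. by move=> mA; rewrite hnu. Qed.

Lemma nu_setIK (A : set (Rd R d)) : measurable (K : set (Rd R d)) -> measurable A ->
  nu (A `&` K) = nu A.
Proof. by move=> mK mA; rewrite !hnu ?setIA -?setIA ?setIid //; exact: measurableI. Qed.

(* A vanishing or infinite Hausdorff measure makes the quotient [x / 0 = 0],
   that is, [nu = 0], for which every function is a.e. constant. *)
Lemma hmeasure_neq0 (D : (Rd R d -> R) -> Prop) :
  has_nonconstant nu D -> fine (hmeasure alpha K) != 0.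
Proof.
move=> [u [_ nc]]; apply/eqP => h0; apply: nc; exists 0.
by exists setT; split => //; rewrite hnu // h0 invr0 mulr0.
Qed.

Lemma nu_similar (f : 'rV[R]_d -> 'rV[R]_d) (s : R) : 0 <= alpha -> 0 < s ->
  is_similitude f s -> fine (hmeasure alpha K) != 0 ->
  f @` K `<=` K -> measurable (f @` K : set (Rd R d)) ->
  nu (f @` K) = (s `^ alpha)%:E.
Proof.
move=> a0 s0 sf hK fK mfK; rewrite hnu // (setIidl fK) (hmeasure_similitude _ _ _ _ a0 s0 sf) //.
(* [fine] sends both infinities to 0, so [hK] also makes the measure finite, and it cancels in the
   quotient. *)
have /fineK <- : hmeasure alpha K \is a fin_num.
  by move: hK; case: hmeasure => //=; rewrite eqxx.
by rewrite -EFinM /= mulfK.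
Qed.

End NormalizedHausdorff.

(** * Absence of gaps in the essential range when [alpha < beta] *)

Section Gap.
Context {R : realType} {d N : nat} (S : 'I_N -> 'rV[R]_d -> 'rV[R]_d) (r : 'I_N -> R).
Context (K : set 'rV[R]_d) (alpha beta : R) (nu : {measure set (Rd R d) -> \bar R}).
Context (hr : forall i, 0 < r i < 1) (hS : forall i, is_similitude (S i) (r i)).
Context (hK : attractor S K) (hsum : \sum_(i < N) r i `^ alpha = 1).
Context (hnu : normalized_hausdorff nu alpha K) (cK : connected K).
Context (hK0 : fine (hmeasure alpha K) != 0) (a0 : 0 <= alpha) (ab : alpha < beta).

Let E w : set (Rd R d) := wmap S w @` K.
Let m w : R := wratio r w `^ alpha.

Lemma cell_closed w : closed (wmap S w @` K).
Proof.
have [cptK _ _] := hK; apply: compact_closed; first exact: norm_hausdorff.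
apply: continuous_compact => //; apply: continuous_subspaceT.
exact: similitude_continuous (wratio_gt0 r w hr) (wmap_similitude S r w hS).
Qed.

Lemma cell_measurable w : measurable (E w).
Proof. by apply: closed_measurable_Rd; exact: cell_closed. Qed.

Lemma attractor_measurable : measurable (K : set (Rd R d)).
Proof. by have := cell_measurable [::]; rewrite /E /= image_id. Qed.

Lemma nu_cell w : nu (E w) = (m w)%:E.
Proof.
have [_ _ KS] := hK.
apply: (nu_similar _ _ _ hnu _ _ a0 (wratio_gt0 r w hr) (wmap_similitude S r w hS)) => //.
  exact: wmap_sub.
exact: cell_measurable.
Qed.

(** Both cells have diameter at most [rho * D] and share [z], which bounds the denominator; the
    numerator is at least the square of the gap [c - a]. *)
Lemma cell_energy (u : Rd R d -> R) (a c D rho : R) v w z :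
  a < c -> 0 < alpha + beta -> (forall x y, K x -> K y -> enorm (x - y) <= D) ->
  0 <= D -> wratio r v <= rho -> wratio r w <= rho -> E v z -> E w z ->
  forall x y, E v x -> c <= u x -> E w y -> u y <= a ->
  (c - a) ^+ 2 / (2 * (rho * D)) `^ (alpha + beta) <=
  `|u x - u y| ^+ 2 / enorm ((x : 'rV[R]_d) - (y : 'rV[R]_d)) `^ (alpha + beta).
Proof.
move=> ac ab0 hD D0 vrho wrho [z1 Kz1 <-] [z2 Kz2 z12] x y [x' Kx' <-] cx [y' Ky' <-] ya.
set X := wmap S v x' in cx *; set Y := wmap S w y' in ya *.
(* [u] separates [X] from [Y], so they differ. This matters because division by 0 gives 0: on the
   diagonal the quotient vanishes. *)
have XY : 0 < enorm (X - Y).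
  rewrite lt_neqAle enorm_ge0 andbT eq_sym; apply/eqP => /enorm_eq0/eqP.
  by rewrite subr_eq0 => /eqP XY; move: cx ya; rewrite XY => cy; rewrite leNgt (lt_le_trans ac).
have XYD : enorm (X - Y) <= 2 * (rho * D).
  apply: (@enorm_sub_le _ _ _ _ (wmap S v z1)).
    rewrite (wmap_similitude S r v hS) ler_pM ?enorm_ge0 ?hD //.
    exact/ltW/wratio_gt0.
  rewrite -z12 (wmap_similitude S r w hS) ler_pM ?enorm_ge0 ?hD //.
  exact/ltW/wratio_gt0.
apply: ler_pM; rewrite ?sqr_ge0 ?invr_ge0 ?powR_ge0 //.
  by rewrite ler_pXn2r ?nnegrE ?subr_ge0 ?(ltW ac) // ler_normr; apply/orP; left; lra.
rewrite lef_pV2 ?posrE ?powR_gt0 ?(lt_le_trans XY) //.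
by rewrite ge0_ler_powR ?nnegrE ?enorm_ge0 ?(ltW ab0) // (le_trans (enorm_ge0 (X - Y))).
Qed.

Lemma besov_gap (u : Rd R d -> R) (a c : R) : besov nu K alpha beta u -> a < c ->
  (0 < nu [set x | (u x <= a)%R])%E -> (0 < nu [set x | (c <= u x)%R])%E ->
  (0 < nu [set x | (a < u x < c)%R])%E.
Proof.
move=> [mu _ Ifin] ac nB nA; rewrite lt0e measure_ge0 andbT; apply/eqP => nM.
have [cptK [x0 Kx0] KS] := hK.
set A := [set x | c <= u x] in nA; set B := [set x | u x <= a] in nB.
set M := [set x | a < u x < c] in nM.
have mA : measurable A by exact: measurable_superlevel.
have mB : measurable B by exact: measurable_sublevel.
have mM : measurable M by exact: measurable_between.
have mK := attractor_measurable.
have mE w := cell_measurable w.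
have EK w : E w `<=` K by exact: wmap_sub.
have [D D0 hD] := compact_ediam K cptK.
have [q0 q00 hq0] := ratio_lower_bound r hr.
(* [cut_set] asks for a constant strictly below 1. *)
pose q := Num.min q0 2^-1.
have q01 : 0 < q < 1 by rewrite lt_min q00 invr_gt0 ltr0n /= gt_min invf_lt1 ?ltr1n // orbT.
have hq i : q <= r i by rewrite ge_min hq0.
have [q_gt0 _] := andP q01.
pose nA' := fine (nu A); pose nB' := fine (nu B).
have nA'0 : 0 < nA' by rewrite fine_gt0 // nA ltey_eq (nu_fin _ _ _ hnu).
have nB'0 : 0 < nB' by rewrite fine_gt0 // nB ltey_eq (nu_fin _ _ _ hnu).
(* With [e <= 8^-1], a cell mostly in [A] leaves [B] at most a quarter of any cell it meets, so the
   majority passes on. The other two terms make the final bounds [nA' <= 2 * e] and [nB' <= 2 * e]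
   absurd. *)
pose e := Num.min (8^-1) (Num.min (nA' / 4) (nB' / 4)).
have e0 : 0 < e by rewrite !lt_min !divr_gt0 // invr_gt0 ltr0n.
have [e1 eA eB] : [/\ e <= 8^-1, e <= nA' / 4 & e <= nB' / 4].
  by rewrite !ge_min !lexx !orbT.
set I := (\int[nu]_(x in _) _)%E in Ifin.
have I0 : (0 <= I)%E.
  apply: integral_ge0 => x _; apply: integral_ge0 => y _.
  by rewrite lee_fin divr_ge0 ?sqr_ge0 ?powR_ge0.
have IE : I = (fine I)%:E by rewrite fineK // ge0_fin_numE.
have ca0 : 0 < (c - a) ^+ 2 by rewrite exprn_gt0 // subr_gt0.
have [rho rho01 hrho] := scale_choice (fine I) _ _ _ _ _ _ D0 q_gt0 ab e0 ca0.
have /andP[rho0 _] := rho01.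
have [L [Lb Lcov Lsum]] := cut_set S r K alpha q hr q01 hq KS hsum rho rho01.
pose m0 := (rho * q) `^ alpha.
have m00 : 0 < m0 by rewrite powR_gt0 // mulr_gt0.
have m0m w : w \in L -> m0 <= m w.
  move=> /Lb/andP[h _]; rewrite ge0_ler_powR // nnegrE; last exact/ltW/wratio_gt0.
  by rewrite mulr_ge0 // ltW.
pose fa w := fine (nu (A `&` E w)); pose fb w := fine (nu (B `&` E w)).
have faE w : nu (A `&` E w) = (fa w)%:E.
  by rewrite fineK // (nu_fin _ _ _ hnu) //; exact: measurableI.
have fbE w : nu (B `&` E w) = (fb w)%:E.
  by rewrite fineK // (nu_fin _ _ _ hnu) //; exact: measurableI.
(* [A] and [B] are disjoint, and what they miss of a cell lies in the null set [M]. *)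
have fab w : fa w + fb w = m w.
  apply: EFin_inj; rewrite EFinD -faE -fbE -nu_cell.
  rewrite (measureDI nu (mE w) mA) (measureDI nu (measurableD (mE w) mA) mB).
  rewrite [X in (_ = X + _ + _)%E](_ : _ = 0%E) ?add0e; last first.
    apply: (@subset_measure0 _ _ _ nu _ M) => //.
      by apply: measurableD => //; exact: measurableD.
    by move=> x [[_ nAx] nBx]; apply/andP; split; rewrite ltNge; apply/negP.
  rewrite addeC [E w `&` A]setIC; congr (nu _ + _)%E; apply/seteqP; split => x.
    move=> [Bx Ex]; split => //; split => // Ax.
    by move: (le_lt_trans Bx ac); rewrite ltNge Ax.
  by move=> [[Ex _] Bx].
(* The energy restricted to the part of [A] in one cell times the part of [B] in the other is at
   most the total energy; the choice of [rho] turns this into a bound relative to the squared least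
   cell mass. *)
have hab v w z : v \in L -> w \in L -> E v z -> E w z -> fa v * fb w <= e * m0 ^+ 2.
  move=> vL wL vz wz.
  have /andP[_ v1] := Lb v vL; have /andP[_ w1] := Lb w wL.
  have ab0 : 0 < alpha + beta by rewrite ltr_wpDl // (le_lt_trans a0 ab).
  have X0 : 0 < (2 * (rho * D)) `^ (alpha + beta) by rewrite powR_gt0 // !mulr_gt0.
  have := @double_integral_ge _ _ _ nu K (A `&` E v) (B `&` E w)
    ((c - a) ^+ 2 / (2 * (rho * D)) `^ (alpha + beta))
    (fun x y => (`|u x - u y| ^+ 2 /
       enorm ((x : 'rV[R]_d) - (y : 'rV[R]_d)) `^ (alpha + beta))%:E).
  rewrite -/I IE -!setIA !(setIidl (@EK _)) fbE faE -!EFinM lee_fin.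
  move=> /(_ mK (measurableI _ _ mA (mE v)) (measurableI _ _ mB (mE w))) h.
  have {}h : (c - a) ^+ 2 / (2 * (rho * D)) `^ (alpha + beta) * fb w * fa v <= fine I.
    apply: h.
    - by rewrite divr_ge0 // ltW.
    - by move=> x y; rewrite lee_fin divr_ge0 ?sqr_ge0 ?powR_ge0.
    - move=> x y [cx vx] [ya wy]; rewrite lee_fin.
      exact: (cell_energy _ _ _ _ _ v w z ac ab0 hD (ltW D0) v1 w1).
  rewrite -(ler_pM2l ca0); apply: (@le_trans _ _ (fine I * (2 * (rho * D)) `^ (alpha + beta))).
    rewrite -ler_pdivrMr //; apply: le_trans h; rewrite le_eqVlt; apply/orP; left; apply/eqP; ring.
  by apply: le_trans hrho _; rewrite le_eqVlt; apply/orP; left; apply/eqP; rewrite -/m0; ring.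
have fa0 w : 0 <= fa w by exact: fine_ge0.
have fb0 w : 0 <= fb w by exact: fine_ge0.
have m_gt0 w : w \in L -> 0 < m w by move=> /m0m; exact: lt_le_trans.
have En0 w : exists z, E w z by exists (wmap S w x0); exists x0.
(* The masses of the cut set add up to 1, so a share [2 * e] of every cell is at most [2 * e] in
   all. *)
have cover_le C : measurable C -> (forall w, w \in L -> (nu (C `&` E w) <= (2 * e * m w)%:E)%E) ->
    fine (nu C) <= 2 * e.
  move=> mC Ck; have mCK : measurable (C `&` K) by exact: measurableI.
  rewrite -lee_fin fineK ?(nu_fin _ _ _ hnu) // -(nu_setIK _ _ _ hnu) //.
  apply: le_trans (measure_cover_le nu _ L E _ mCK mE _) _.
    move=> x [_ Kx]; have [w wL wx] := Lcov x Kx.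
    by rewrite -bigcup_seq; exists w.
  have -> : 2 * e = \sum_(w <- L) 2 * e * m w by rewrite -mulr_sumr Lsum mulr1.
  rewrite -sumEFin big_seq [leRHS]big_seq.
  apply: lee_sum => w wL; rewrite -setIA (setIidr (@EK _)); exact: Ck.
pose P w := m w / 2 < fa w.
have b_le v w z : v \in L -> w \in L -> E v z -> E w z -> P v -> fb w <= 2 * e * m w.
  move=> vL wL vz wz Pv; apply: (half_mass_le m0 (m v) _ (fa v));
    rewrite ?m0m ?(ltW e0) ?(ltW Pv) //.
  exact: hab vz wz.
have [Pex|nP] := pselect (exists2 w, w \in L & P w).
  have allP : forall w, w \in L -> P w.
    apply: (@connected_cells _ _ K L (fun w => wmap S w @` K)) => //.
    - by move=> w _; exact: cell_closed.
    - by move=> w _; exact: En0.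
    - by move=> w _; exact: EK.
    move=> v w z vL wL vz wz Pv; have := b_le v w z vL wL vz wz Pv.
    have := m_gt0 w wL; have := fab w; rewrite /P; nra.
  (* Every cell is mostly in [A]; since a cell meets itself, [b_le] with [v = w] bounds [B] in
     each. *)
  suff : nB' <= 2 * e by lra.
  apply: cover_le => // w wL; rewrite fbE lee_fin; have [z zw] := En0 w.
  exact: (b_le _ _ _ wL wL zw zw (allP w wL)).
(* No cell is mostly in [A], so [B] fills at least half of each; comparing each cell with itself
   bounds [A]. *)
suff : nA' <= 2 * e by lra.
apply: cover_le => // w wL; rewrite faE lee_fin; have [z zw] := En0 w.
apply: (half_mass_le m0 (m w) _ (fb w)); rewrite ?m0m ?(ltW e0) //; last first.
  by rewrite mulrC; exact: (hab _ _ _ wL wL zw zw).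
have : ~~ P w by apply/negP => Pw; apply: nP; exists w.
by rewrite /P -leNgt; have := fab w; lra.
Qed.

End Gap.

(** * Functions constant almost everywhere *)

Section AlmostEverywhere.
Context {dd} {T : measurableType dd} {R : realType} (mu : {measure set T -> \bar R}).

Lemma ae_positive_exists (A : set T) (P : T -> Prop) : measurable A -> (0 < mu A)%E ->
  {ae mu, forall x, P x} -> exists2 x, A x & P x.
Proof.
move=> mA A0 [Z [mZ Z0 PZ]]; apply: contrapT => nex.
move: A0; rewrite (@subset_measure0 _ _ _ mu A Z) ?ltxx // => x Ax.
by apply: PZ => Px; apply: nex; exists x.
Qed.

(** Failing such a pair, a non-null sublevel set at [a] forces a null superlevel set at every
    [c > a]. Then [u] equals a.e. the infimum of the levels whose sublevel set is non-null. *)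
Lemma nonconstant_split (u : T -> R) : measurable_fun setT u ->
  ~ (exists c : R, {ae mu, forall x, u x = c}) ->
  exists a c, [/\ a < c, (0 < mu [set x | (u x <= a)%R])%E &
                  (0 < mu [set x | (c <= u x)%R])%E].
Proof.
move=> mu_u nc; apply: contrapT => nex; apply: nc.
have mL a : measurable [set x | u x <= a] by exact: measurable_sublevel.
have mG c : measurable [set x | c <= u x] by exact: measurable_superlevel.
pose L a := mu [set x | u x <= a] = 0%E; pose G c := mu [set x | c <= u x] = 0%E.
have LG a c : a < c -> ~ L a -> G c.
  move=> ac nL; apply: contrapT => nG; apply: nex; exists a, c.
  by split => //; rewrite lt0e measure_ge0 andbT; apply/eqP.
have Ln a : L a -> mu.-negligible [set x | u x <= a] by move=> La; apply/negligibleP.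
have Gn c : G c -> mu.-negligible [set x | c <= u x] by move=> Gc; apply/negligibleP.
(* If all sublevel sets are null, so is the whole space, and any constant will do; likewise for
   superlevel sets. Excluding both makes [X] nonempty and bounded below. *)
have [allL|/existsNP[a1 na1]] := pselect (forall a, L a).
  exists 0; apply: (@negligibleS _ _ _ mu (\bigcup_n [set x | u x <= n%:R]) _).
    by move=> x _; exists (Num.truncn (u x)).+1 => //=; exact/ltW/truncnS_gt.
  by apply: negligible_bigcup => n; exact/Ln/allL.
have [allG|/existsNP[c1 nc1]] := pselect (forall c, G c).
  exists 0; apply: (@negligibleS _ _ _ mu (\bigcup_n [set x | - n%:R <= u x]) _).
    move=> x _; exists (Num.truncn (- u x)).+1 => //=; rewrite lerNl; exact/ltW/truncnS_gt.
  by apply: negligible_bigcup => n; exact/Gn/allG.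
pose X := [set t | ~ L t].
have hX : has_inf X.
  split; first by exists a1.
  by exists c1 => t nLt; rewrite leNgt; apply/negP => tc; apply: nc1; exact: LG nLt.
exists (inf X); apply: (@negligibleS _ _ _ mu
  ((\bigcup_n [set x | u x <= inf X - n.+1%:R^-1]) `|`
   (\bigcup_n [set x | inf X + n.+1%:R^-1 <= u x])) _).
  have arch (e : R) : 0 < e -> exists n : nat, n.+1%:R^-1 <= e.
    move=> e0; exists (Num.truncn e^-1); rewrite -[leRHS]invrK lef_pV2 ?posrE ?invr_gt0 //.
    exact/ltW/truncnS_gt.
  move=> x /eqP; rewrite neq_lt => /orP[xc|xc].
    left; have [|n hn] := arch (inf X - u x); first by rewrite subr_gt0.
    by exists n => //=; rewrite lerBrDl -lerBrDr.
  right; have [|n hn] := arch (u x - inf X); first by rewrite subr_gt0.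
  by exists n => //=; rewrite -lerBrDl.
have n0 n : 0 < n.+1%:R^-1 :> R by rewrite invr_gt0.
apply: negligibleU; apply: negligible_bigcup => n.
  apply: Ln; apply: contrapT => nL.
  by have := inf_lbound hX.2 nL; rewrite leNgt gtrBl n0.
apply: Gn; have [t nLt tX] := inf_adherent (n0 n) hX.
exact: LG nLt.
Qed.

(** Two a.e. constant functions are dependent: the relation with coefficients [c1] and [- c0] forces
    both constants to vanish, and then coefficients 1 and 1 also give a relation. *)
Lemma infinite_dim_nonconstant {d : nat} (nu : {measure set (Rd R d) -> \bar R}) D :
  infinite_dim nu D -> has_nonconstant nu D.
Proof.
move=> /(_ 2)[u [Du indep]]; apply: contrapT => nc.
have cst i : exists c, {ae nu, forall x, u i x = c}.
  by apply: contrapT => h; apply: nc; exists (u i).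
have [c0 h0] := cst ord0; have [c1 h1] := cst (lift ord0 ord0).
have sumE (a0 a1 : R) : a0 * c0 + a1 * c1 = 0 -> a0 = 0 /\ a1 = 0.
  move=> a01; pose a (i : 'I_2) := if i == ord0 then a0 else a1.
  have za : forall i, a i = 0.
    apply: indep; apply: filterS2 h0 h1 => x e0 e1.
    by rewrite !big_ord_recl big_ord0 addr0 e0 e1.
  by split; [exact: (za ord0)|exact: (za (lift ord0 ord0))].
have [c10 c00] : c1 = 0 /\ - c0 = 0 by apply: sumE; ring.
have [|/eqP] := sumE 1 1; last by rewrite oner_eq0.
by rewrite c10 -[c0]opprK c00 oppr0 !mulr0 addr0.
Qed.

End AlmostEverywhere.

(** * Tent functions *)

Section Tent.
Context {R : realType}.

(** The slopes, not the height, are normalized to 1, so that composing with a tent does not increase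
    the energy. *)
Definition tent (p q t : R) : R := Num.max 0 (Num.min (t - p) (q - t)).

Lemma tent_lipschitz p q s t : `|tent p q s - tent p q t| <= `|s - t|.
Proof.
have le x y : tent p q x - tent p q y <= `|x - y|.
  have xy := ler_norm (x - y); have yx := ler_norm (y - x); rewrite distrC in yx.
  have m1 : Num.min (x - p) (q - x) <= x - p by rewrite ge_min lexx.
  have m2 : Num.min (x - p) (q - x) <= q - x by rewrite ge_min lexx orbT.
  rewrite lerBlDl -lerBlDr {1}/tent lerBlDr ge_max addr_ge0 /= ?le_max ?lexx //.
  by rewrite -lerBlDr /tent le_max le_min; apply/orP; right; apply/andP; split; lra.
rewrite ler_norml le andbT lerNl opprB distrC; exact: le.
Qed.

Lemma tent_bounded p q t : `|tent p q t| <= `|q - p|.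
Proof.
rewrite /tent ger0_norm ?le_max ?lexx // ge_max normr_ge0 /= ge_min.
apply/orP; have := normr_ge0 (q - p); have := ler_norm (q - p).
by case: (leP (t - p) `|q - p|) => h1 h2 h3; [left|right; lra].
Qed.

Lemma tent_gt0 p q t : p < t < q -> 0 < tent p q t.
Proof. by move=> /andP[pt tq]; rewrite lt_max lt_min !subr_gt0 pt tq orbT. Qed.

Lemma tent_eq0 p q t : (t <= p) || (q <= t) -> tent p q t = 0.
Proof. by move=> h; apply/max_l; rewrite ge_min !subr_le0. Qed.

Lemma tent_measurable p q : measurable_fun setT (tent p q).
Proof.
apply: measurable_maxr => //; apply: measurable_minr; apply: measurable_funB => //.
Qed.

End Tent.

(** * Contractions and independent families in the Besov space *)

Section Besov.
Context {R : realType} {d : nat} (K : set 'rV[R]_d) (alpha beta : R).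
Context (nu : {measure set (Rd R d) -> \bar R}).

(** A contraction lowers the energy integrand pointwise; square integrability comes from the bound
    [M] and the finiteness of [nu K]. *)
Lemma besov_comp (u : Rd R d -> R) (phi : R -> R) (M : R) :
  measurable (K : set (Rd R d)) -> nu K \is a fin_num ->
  measurable_fun setT phi -> (forall t, `|phi t| <= M) ->
  (forall s t, `|phi s - phi t| <= `|s - t|) ->
  besov nu K alpha beta u -> besov nu K alpha beta (phi \o u).
Proof.
move=> mK fK mphi phiM philip [mu_u _ Ifin]; split.
- exact: measurableT_comp.
- apply: (@le_lt_trans _ _ (\int[nu]_(x in (K : set (Rd R d))) (cst (M ^+ 2)%:E x))%E).
    apply: le_integral_nonneg => x _; first by rewrite lee_fin sqr_ge0.
    have M0 : 0 <= M by exact: le_trans (normr_ge0 _) (phiM 0).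
    by rewrite lee_fin ler_pXn2r ?nnegrE ?normr_ge0 //; exact: phiM.
  by rewrite integral_cst // -(fineK fK) -EFinM ltry.
- apply: le_lt_trans Ifin; apply: le_integral_nonneg => x _.
    by apply: integral_ge0 => y _; rewrite lee_fin divr_ge0 ?sqr_ge0 ?powR_ge0.
  apply: le_integral_nonneg => y _.
    by rewrite lee_fin divr_ge0 ?sqr_ge0 ?powR_ge0.
  rewrite lee_fin ler_wpM2r ?invr_ge0 ?powR_ge0 // ler_pXn2r ?nnegrE ?normr_ge0 //.
  exact: philip.
Qed.

End Besov.

Lemma besov_infinite_dim {R : realType} {d N : nat}
    (S : 'I_N -> 'rV[R]_d -> 'rV[R]_d) (r : 'I_N -> R)
    (K : set 'rV[R]_d) (alpha beta : R) (nu : {measure set (Rd R d) -> \bar R}) :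
  (forall i, 0 < r i < 1) -> (forall i, is_similitude (S i) (r i)) ->
  attractor S K -> \sum_(i < N) r i `^ alpha = 1 -> normalized_hausdorff nu alpha K ->
  connected K -> 0 <= alpha -> alpha < beta ->
  has_nonconstant nu (besov nu K alpha beta) -> infinite_dim nu (besov nu K alpha beta).
Proof.
move=> hr hS hK hsum hnu cK a0 ab hnc n; have hK0 := hmeasure_neq0 _ _ _ hnu _ hnc.
have [u [Du /nonconstant_split]] := hnc; have [mu_u _ _] := Du.
move=> /(_ mu_u)[a [c [ac ha hc]]].
have mK := attractor_measurable S r K hr hS hK.
(* The empty family settles [n = 0], where [s] would divide by 0. *)
have [n0|n0] := posnP n.
  by subst n; exists (fun _ => u); split => [[]|? _ []].
pose s := (c - a) / n%:R; pose p (k : nat) := a + s * k%:R.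
have s0 : 0 < s by rewrite divr_gt0 ?subr_gt0 // ltr0n.
have pS j k : (j <= k)%N -> p j <= p k by move=> jk; rewrite lerD2l ler_pM2l // ler_nat.
have pn : p n = c by rewrite /p /s divfK ?pnatr_eq0 -?lt0n //; ring.
have p0 : p 0 = a by rewrite /p mulr0 addr0.
have gap (k : 'I_n) : (0 < nu [set x | (p k < u x < p k.+1)%R])%E.
  apply: (besov_gap S r K alpha beta nu hr hS hK hsum hnu cK hK0 a0 ab u) => //.
  - by rewrite ltrD2l ltr_pM2l // ltr_nat.
  - apply: lt_le_trans ha _; apply: le_measure; rewrite ?inE; [exact: measurable_sublevel..|].
    by move=> x /= /le_trans; apply; rewrite -p0 pS.
  - apply: lt_le_trans hc _; apply: le_measure; rewrite ?inE; [exact: measurable_superlevel..|].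
    by move=> x /=; apply: le_trans; rewrite -pn pS.
exists (fun k => tent (p k) (p k.+1) \o u); split => [k|b hb k].
  apply: (besov_comp K alpha beta nu u _ `|p k.+1 - p k|) => //.
  - exact: (nu_fin _ _ _ hnu).
  - exact: tent_measurable.
  - by move=> t; exact: tent_bounded.
  - exact: tent_lipschitz.
(* At a point where [u] lies in the [k]-th subinterval only the [k]-th tent is nonzero, so a
   vanishing combination has [b k = 0]. *)
have [|x /= xk] := ae_positive_exists nu _ _ _ (gap k) hb; first exact: measurable_between.
rewrite (bigD1 k) //= big1 ?addr0 => [/eqP|j jk].
  by rewrite mulf_eq0 (gt_eqF (tent_gt0 _ _ _ xk)) orbF => /eqP.
have /andP[kx xk'] := xk.
rewrite tent_eq0 ?mulr0 //; apply/orP.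
case: (ltngtP j k) => [jk'|jk'|/val_inj jk']; last by rewrite jk' eqxx in jk.
- by right; exact: le_trans (pS _ _ jk') (ltW kx).
- by left; exact: le_trans (ltW xk') (pS _ _ jk').
Qed.

(** A negative exponent would make each of the at least two terms at least 1. *)
Lemma similarity_dimension_ge0 {R : realType} {N : nat} (r : 'I_N -> R) (alpha : R) :
  (2 <= N)%N -> (forall i, 0 < r i < 1) -> \sum_(i < N) r i `^ alpha = 1 -> 0 <= alpha.
Proof.
move=> N2 hr hsum; rewrite leNgt; apply/negP => a0.
have : \sum_(i < N) (1 : R) <= 1.
  rewrite -[leRHS]hsum; apply: ler_sum => i _; have /andP[r0 r1] := hr i.
  by rewrite -(powRr0 (r i)); apply: ger_powR; rewrite ?r0 ltW.
by rewrite sumr_const card_ord -[leRHS]/(1%:R) ler_nat leqNgt N2.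
Qed.

Theorem theorem4p6 (R : realType) (d N : nat)
    (S : 'I_N -> 'rV[R]_d -> 'rV[R]_d) (r : 'I_N -> R)
    (K : set 'rV[R]_d) (alpha : R) (nu : {measure set (Rd R d) -> \bar R}) :
  (2 <= N)%N ->
  (forall i, 0 < r i < 1) ->
  (forall i, is_similitude (S i) (r i)) ->
  OSC S ->
  attractor S K ->
  \sum_(i < N) r i `^ alpha = 1 ->
  normalized_hausdorff nu alpha K ->
  connected K ->
  (exists beta, alpha < beta /\ has_nonconstant nu (besov nu K alpha beta)) ->
  beta2 nu K alpha = beta3 nu K alpha.
Proof.
move=> N2 hr hS _ hK hsum hnu cK [b0 [ab0 nc0]].
have a0 := similarity_dimension_ge0 r alpha N2 hr hsum.
apply/eqP; rewrite eq_le; apply/andP; split.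
  apply: ereal_sup_le => _ [b [b_gt0 binf] <-]; exists b; last by [].
  by split; [exact: b_gt0|exact: (infinite_dim_nonconstant nu)].
apply: ge_ereal_sup => _ [b [b_gt0 bnc] <-].
(* The larger of [b] and [b0]: an exponent [b] that may not exceed [alpha] is replaced by [b0],
   which does. *)
have [b' [bb' ab' nc']] : exists b', [/\ b <= b', alpha < b' &
    has_nonconstant nu (besov nu K alpha b')].
  by case: (leP b b0) => bb0; [exists b0|exists b; split => //; exact: lt_trans bb0].
apply: (@le_trans _ _ b'%:E); first by rewrite lee_fin.
apply: ereal_sup_ubound; exists b'; last by [].
split; first exact: lt_le_trans bb'.
exact: (besov_infinite_dim S r K alpha b' nu hr hS hK hsum hnu cK a0 ab' nc').
Qed.
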